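(* The logic AMLFI1 is (weakly) complete: for every $\alpha \in \mathcal{L}_{AM}$, $\vDash_{AMLFI1} \alpha$ implies $\vdash_{AMLFI1} \alpha$.
   Context: **Language.** $P$ is a countable set of propositional variables and $N$ a finite set of agents. The formulas of $\mathcal{L}_{AM}$ and the action models are defined by simultaneous recursion. Formulas: $\alpha ::= p \mid \neg\alpha \mid \bullet\alpha \mid (\alpha\land\alpha) \mid K_i\alpha \mid [U,e]\alpha$, with $p\in P$, $i\in N$, $U$ an action model and $e$ an action of $U$. An action model is $U=\langle E,\{\sim_i\}_{i\in N},\mathrm{pre}\rangle$ with $E$ a finite non-empty set of actions, each $\sim_i$ an equivalence relation on $E$, and $\mathrm{pre}:E\to\mathcal{L}_{AM}$ (preconditions). **Abbreviations.** $\circ\alpha:=\neg\bullet\alpha$; $\alpha\lor\beta:=\neg(\neg\alpha\land\neg\beta)$; $\sim\!\alpha:=\neg\alpha\land\circ\alpha$; $\alpha\to\beta:=\ \sim\!\alpha\lor\beta$; $\alpha\leftrightarrow\beta:=(\alpha\to\beta)\land(\beta\to\alpha)$; $\alpha\equiv\beta:=(\alpha\leftrightarrow\beta)\land(\neg\alpha\leftrightarrow\neg\beta)$; $\hat K_i\alpha:=\neg K_i\neg\alpha$. **Proof system AMLFI1** (all schemata range over formulas of $\mathcal{L}_{AM}$, $i\in N$, $p\in P$). LFI1 part: A1 $\alpha\to(\beta\to\alpha)$; A2 $(\alpha\to(\beta\to\gamma))\to((\alpha\to\beta)\to(\alpha\to\gamma))$; A3 $\alpha\to(\beta\to(\alpha\land\beta))$;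 A4 $(\alpha\land\beta)\to\alpha$; A5 $(\alpha\land\beta)\to\beta$; A6 $\alpha\to(\alpha\lor\beta)$; A7 $\beta\to(\alpha\lor\beta)$; A8 $(\alpha\to\gamma)\to((\beta\to\gamma)\to((\alpha\lor\beta)\to\gamma))$; A9 $\alpha\lor(\alpha\to\beta)$; A10 $\alpha\lor\neg\alpha$; A11 $\circ\alpha\to(\alpha\to(\neg\alpha\to\beta))$; A12 $\bullet\alpha\to(\alpha\land\neg\alpha)$; A13 $\neg\neg\alpha\leftrightarrow\alpha$; A14 $\neg(\alpha\lor\beta)\leftrightarrow(\neg\alpha\land\neg\beta)$; A15 $\neg(\alpha\land\beta)\leftrightarrow(\neg\alpha\lor\neg\beta)$; A16 $\neg(\alpha\to\beta)\leftrightarrow(\alpha\land\neg\beta)$; rule MP: $\alpha,\alpha\to\beta\Rightarrow\beta$. Modal (S5LFI1) part: K $K_i(\alpha\to\beta)\to(K_i\alpha\to K_i\beta)$; K$_1$ $K_i(\alpha\to\beta)\to(\hat K_i\alpha\to\hat K_i\beta)$; K$_2$ $\hat K_i(\alpha\lor\beta)\to(\hat K_i\alpha\lor\hat K_i\beta)$; K$_3$ $(\hat K_i\alpha\to K_i\beta)\to K_i(\alpha\to\beta)$; T $K_i\alpha\to\alpha$; 4 $K_i\alpha\to K_iK_i\alpha$; 5 $\hat K_i\alpha\to K_i\hat K_i\alpha$; T$'$ $\alpha\to\hat K_i\alpha$; 4$'$ $\hat K_i\hat K_i\alpha\to\hat K_i\alpha$; 5$'$ $\hat K_iK_i\alpha\to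 K_i\alpha$; rule Nec: $\alpha\Rightarrow K_i\alpha$. Dynamic part: AM1 $[U,e]p\equiv(\mathrm{pre}(e)\to p)$; AM2 $[U,e]\neg\alpha\equiv(\mathrm{pre}(e)\to\neg[U,e]\alpha)$; AM3 $[U,e]\bullet\alpha\equiv(\mathrm{pre}(e)\to\bullet[U,e]\alpha)$; AM4 $[U,e](\alpha\land\beta)\equiv([U,e]\alpha\land[U,e]\beta)$; AM5 $[U,e]K_i\alpha\equiv(\mathrm{pre}(e)\to\bigwedge_{e\sim_i f}K_i[U,f]\alpha)$; rule RE: $\theta\equiv\gamma\Rightarrow\alpha\equiv\alpha(\theta/\gamma)$, where $\alpha(\theta/\gamma)$ is $\alpha$ with occurrences of $\theta$ replaced by $\gamma$ (in $[U,e]\delta$ the replacement acts in $\delta$; the action model is left unchanged). $\vdash_{AMLFI1}\alpha$ means $\alpha$ is obtainable by a finite derivation from the axioms using the rules. **Semantics.** Truth values $\{0,\tfrac12,1\}$, designated values $D=\{1,\tfrac12\}$. A Kripke model is $M=\langle S,\{\sim_i\}_{i\in N},\vartheta\rangle$ with $S$ a set of states, each $\sim_i$ an equivalence relation on $S$, and for each $s\in S$ a map $\vartheta_s:P\to\{0,\tfrac12,1\}$, extended to formulas by: $\vartheta_s(\neg\alpha)=1-\vartheta_s(\alpha)$; $\vartheta_s(\bullet\alpha)=1$ if $\vartheta_s(\alpha)=\tfrac12$ and $0$ otherwise; $\vartheta_s(\alpha\land\beta)=\min\{\vartheta_s(\alpha),\vartheta_s(\beta)\}$; $\vartheta_s(K_i\alpha)=\inf\{\vartheta_{t}(\alpha):s\sim_i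 t\}$ (with $\inf\emptyset=1$); $\vartheta_s([U,e]\alpha)=\vartheta'_{(s,e)}(\alpha)$ if $\vartheta_s(\mathrm{pre}(e))\in D$, and $1$ otherwise. Here $\vartheta'$ is the valuation of the updated model $M\otimes U=\langle S',\{\sim_i'\},\vartheta'\rangle$ with $S'=\{(t,f):t\in S,f\in E,\vartheta_t(\mathrm{pre}(f))\in D\}$, $(t,f)\sim'_i(u,g)$ iff $t\sim_i u$ and $f\sim_i g$, and $\vartheta'_{(t,f)}(p)=\vartheta_t(p)$ for $p\in P$. $\vDash_{AMLFI1}\alpha$ means: $\vartheta_s(\alpha)\in D$ for every such model and every state $s$. *)

(* Defs.v *)
From mathcomp Require Import all_boot all_order.
From mathcomp Require Import boolp classical_sets.
From Stdlib Require Import RelationClasses.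

Set Implicit Arguments.
Unset Strict Implicit.
Unset Printing Implicit Defensive.

Record action_frame (N : Type) := ActionFrame {
  action :> finType;
  action_nonempty : 0 < #|action|;
  indist : N -> rel action;
  indist_equiv : forall i, equivalence_rel (indist i)
}.

(** An action model is split into its frame [U] and its precondition map [pre],
    since the type of [e] may not depend on a term containing formulas:
    [Upd U pre e a] is the formula [[(U, pre), e] a]. *)
Inductive form (P N : Type) : Type :=
| Var of P
| Neg of form P N
| Bul of form P N
| And of form P N & form P N
| Know of N & form P N
| Upd (U : action_frame N) (pre : U -> form P N) (e : U) (a : form P N).

Arguments Var {P N} p.
Arguments Neg {P N} a.
Arguments Bul {P N} a.
Arguments And {P N} a b.
Arguments Know {P N} i a.
Arguments Upd {P N} U pre e a.

Declare Scope am_scope.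
Delimit Scope am_scope with AM.
Bind Scope am_scope with form.
Local Open Scope am_scope.

Notation "~~ a" := (Neg a) : am_scope.
Notation "a && b" := (And a b) : am_scope.

Definition Circ {P N : Type} (a : form P N) : form P N := ~~ Bul a.
Definition Or {P N : Type} (a b : form P N) : form P N := ~~ (~~ a && ~~ b).
Definition StrongNeg {P N : Type} (a : form P N) : form P N := ~~ a && Circ a.
Definition Imp {P N : Type} (a b : form P N) : form P N := Or (StrongNeg a) b.
Definition Iff {P N : Type} (a b : form P N) : form P N := Imp a b && Imp b a.
Definition Equ {P N : Type} (a b : form P N) : form P N :=
  Iff a b && Iff (~~ a) (~~ b).
Definition Poss {P N : Type} (i : N) (a : form P N) : form P N :=
  ~~ Know i (~~ a).

Notation "a || b" := (Or a b) : am_scope.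
Notation "a ==> b" := (Imp a b) : am_scope.
Notation "a <==> b" := (Iff a b) (at level 60, no associativity) : am_scope.
Notation "a === b" := (Equ a b) (at level 70, no associativity) : am_scope.

(** [d] is only the value of the conjunction of the empty list. *)
Definition bigAnd {P N : Type} (d : form P N) (l : seq (form P N)) : form P N :=
  if l is a :: l' then foldl And a l' else d.

(** The conjunction over all [f] with [e ~_i f] of [K_i [U, f] a]; there is at
    least one conjunct because [indist U i] is reflexive. *)
Definition bigKnow {P N : Type} (U : action_frame N) (pre : U -> form P N)
    (i : N) (e : U) (a : form P N) : form P N :=
  bigAnd a [seq Know i (Upd U pre f a) | f <- enum U & indist i e f].

(** [a (t / g)]: all occurrences of [t] in [a] are replaced by [g], except
    those inside the preconditions of the action models of [a]. *)
Fixpoint replace_all {P N : Type} (t g a : form P N) : form P N :=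
  if `[< a = t >] then g else
  match a with
  | Var p => Var p
  | Neg b => ~~ replace_all t g b
  | Bul b => Bul (replace_all t g b)
  | And b c => replace_all t g b && replace_all t g c
  | Know i b => Know i (replace_all t g b)
  | Upd U pre e b => Upd U pre e (replace_all t g b)
  end.

Inductive provable {P N : Type} : form P N -> Prop :=
| ax_A1 a b : provable (a ==> (b ==> a))
| ax_A2 a b c :
    provable ((a ==> (b ==> c)) ==> ((a ==> b) ==> (a ==> c)))
| ax_A3 a b : provable (a ==> (b ==> (a && b)))
| ax_A4 a b : provable ((a && b) ==> a)
| ax_A5 a b : provable ((a && b) ==> b)
| ax_A6 a b : provable (a ==> (a || b))
| ax_A7 a b : provable (b ==> (a || b))
| ax_A8 a b c :
    provable ((a ==> c) ==> ((b ==> c) ==> ((a || b) ==> c)))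
| ax_A9 a b : provable (a || (a ==> b))
| ax_A10 a : provable (a || ~~ a)
| ax_A11 a b : provable (Circ a ==> (a ==> (~~ a ==> b)))
| ax_A12 a : provable (Bul a ==> (a && ~~ a))
| ax_A13 a : provable (~~ (~~ a) <==> a)
| ax_A14 a b : provable (~~ (a || b) <==> (~~ a && ~~ b))
| ax_A15 a b : provable (~~ (a && b) <==> (~~ a || ~~ b))
| ax_A16 a b : provable (~~ (a ==> b) <==> (a && ~~ b))
| ax_K i a b : provable (Know i (a ==> b) ==> (Know i a ==> Know i b))
| ax_K1 i a b : provable (Know i (a ==> b) ==> (Poss i a ==> Poss i b))
| ax_K2 i a b : provable (Poss i (a || b) ==> (Poss i a || Poss i b))
| ax_K3 i a b : provable ((Poss i a ==> Know i b) ==> Know i (a ==> b))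
| ax_T i a : provable (Know i a ==> a)
| ax_4 i a : provable (Know i a ==> Know i (Know i a))
| ax_5 i a : provable (Poss i a ==> Know i (Poss i a))
| ax_T' i a : provable (a ==> Poss i a)
| ax_4' i a : provable (Poss i (Poss i a) ==> Poss i a)
| ax_5' i a : provable (Poss i (Know i a) ==> Know i a)
| ax_AM1 U pre e p :
    provable (Upd U pre e (Var p) === (pre e ==> Var p))
| ax_AM2 U pre e a :
    provable (Upd U pre e (~~ a) === (pre e ==> ~~ Upd U pre e a))
| ax_AM3 U pre e a :
    provable (Upd U pre e (Bul a) === (pre e ==> Bul (Upd U pre e a)))
| ax_AM4 U pre e a b :
    provable (Upd U pre e (a && b) === (Upd U pre e a && Upd U pre e b))
| ax_AM5 U pre e i a :
    provable (Upd U pre e (Know i a) === (pre e ==> bigKnow pre i e a))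
| rule_MP a b : provable a -> provable (a ==> b) -> provable b
| rule_Nec i a : provable a -> provable (Know i a)
| rule_RE t g a : provable (t === g) -> provable (a === replace_all t g a).

(** [k : 'I_3] stands for the truth value [k / 2], so that [rev_ord] is the map
    [x |-> 1 - x] and the order of ['I_3] is the order of the truth values. The infimum of the
    empty set is the default value [tv1] of [infimum] below. *)
Definition tv0 : 'I_3 := Ordinal (isT : 0 < 3).
Definition tvhalf : 'I_3 := Ordinal (isT : 1 < 3).
Definition tv1 : 'I_3 := Ordinal (isT : 2 < 3).

Definition designated (v : 'I_3) : bool := v \in [:: tv1; tvhalf].

Record kripke (P N : Type) := Kripke {
  state :> Type;
  acc : N -> state -> state -> Prop;
  acc_equiv : forall i, Equivalence (acc i);
  valuation : state -> P -> 'I_3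
}.

Definition updated_state {P N : Type} (M : kripke P N) (U : action_frame N)
    (D : M -> U -> bool) : Type :=
  {x : M * U | D x.1 x.2}.

Definition updated_acc {P N : Type} (M : kripke P N) (U : action_frame N)
    (D : M -> U -> bool) (i : N) (x y : updated_state D) : Prop :=
  acc i (sval x).1 (sval y).1 /\ indist i (sval x).2 (sval y).2.

Lemma updated_acc_equiv {P N : Type} (M : kripke P N) (U : action_frame N)
    (D : M -> U -> bool) (i : N) :
  Equivalence (@updated_acc P N M U D i).
Proof.
have [rM sM tM] := @acc_equiv P N M i; have eqU := @indist_equiv N U i.
split.
- by move=> x; split; [exact: rM | case: (eqU (sval x).2 (sval x).2 (sval x).2)].
- move=> x y [xyM xyU]; split; first exact: sM.
  case: (eqU (sval x).2 (sval y).2 (sval x).2) => xx /(_ xyU) <-.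
  by case: (eqU (sval x).2 (sval x).2 (sval x).2).
- move=> x y z [xyM xyU] [yzM yzU]; split; first exact: tM yzM.
  by case: (eqU (sval x).2 (sval y).2 (sval z).2) => _ /(_ xyU) ->.
Qed.

(** The product update of [M] by an action model with frame [U]; [D t f] tells
    whether the precondition of [f] has a designated value at [t]. *)
Definition update {P N : Type} (M : kripke P N) (U : action_frame N)
    (D : M -> U -> bool) : kripke P N :=
  {| state := updated_state D;
     acc := @updated_acc P N M U D;
     acc_equiv := @updated_acc_equiv P N M U D;
     valuation := fun x => valuation (sval x).1 |}.

(** [insub (s, e)] is [Some] of the state [(s, e)] of the updated model if
    [pre e] is designated at [s], and [None] otherwise. *)
Fixpoint eval {P N : Type} (a : form P N) (M : kripke P N) (s : M) : 'I_3 :=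
  match a with
  | Var p => valuation s p
  | Neg b => rev_ord (eval b s)
  | Bul b => if eval b s == tvhalf then tv1 else tv0
  | And b c => Order.min (eval b s) (eval c s)
  | Know i b => infimum tv1 [set eval b t | t in [set t | acc i s t]]
  | Upd U pre e b =>
      let D t f := designated (eval (pre f) t) in
      if insub (s, e) is Some x then @eval P N b (update D) x else tv1
  end.

Definition valid {P N : Type} (a : form P N) : Prop :=
  forall (M : kripke P N) (s : M), designated (eval a s).

(* Main.v *)
Require Import Defs.
From mathcomp Require Import all_boot all_order.
From mathcomp Require Import boolp classical_sets.
From Stdlib Require List RelationClasses.

(** The reduction axioms and RE rewrite every formula, innermost updates first,
    into a provably and semantically equivalent static (update-free) formula, so
    only static formulas matter.  The formula [StrongNeg a] is a classical
    negation, so every consistent theory extends to one deciding finitely many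
    given formulas.  An unprovable static [b] is refuted in a model whose states
    record, for a theory deciding the subformulas of [b] and their negations, the
    truth values of these subformulas; the states related by [i] are those which
    agree on all formulas [Know i c].  The axioms 4 and 5, applied to [Know i c],
    [~~ Know i c] and their strong negations, make this agreement hold for
    every theory which contains all [c] such that [Know i c] is in the given
    one. *)

Set Implicit Arguments.
Unset Strict Implicit.
Unset Printing Implicit Defensive.

Local Open Scope am_scope.

(** * Theories *)

Section Hilbert.
Variables (P N : Type).
Implicit Types (a b c d t g : form P N) (T : form P N -> Prop).
Implicit Types (L : seq (form P N)).

Definition theory T : Prop :=
  (forall a, provable a -> T a) /\ (forall a b, T (a ==> b) -> T a -> T b).

Lemma theory_provable : theory provable.
Proof. by split=> // a b ab pa; apply: rule_MP ab. Qed.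

Section Theory.
Variables (T : form P N -> Prop) (thT : theory T).

Lemma theory_ax a : provable a -> T a. Proof. exact: thT.1. Qed.

Lemma theory_mp a b : T (a ==> b) -> T a -> T b. Proof. exact: thT.2. Qed.

Lemma theory_mp_ax a b : provable (a ==> b) -> T a -> T b.
Proof. by move=> /theory_ax /theory_mp; apply. Qed.

Lemma theory_weaken a b : T b -> T (a ==> b).
Proof. exact/theory_mp_ax/ax_A1. Qed.

Lemma theory_imp_refl a : T (a ==> a).
Proof.
apply: theory_mp (theory_ax (ax_A1 a a)).
apply: theory_mp (theory_ax (ax_A1 a (a ==> a))).
exact/theory_ax/ax_A2.
Qed.

Lemma theory_and a b : T (a && b) <-> T a /\ T b.
Proof.
split=> [ab|[Ta Tb]].
  by split; apply: theory_mp_ax ab; [exact: ax_A4|exact: ax_A5].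
by apply: theory_mp Tb; apply: theory_mp_ax Ta; exact: ax_A3.
Qed.

Lemma theory_orl a b : T a -> T (a || b).
Proof. exact/theory_mp_ax/ax_A6. Qed.

Lemma theory_orr a b : T b -> T (a || b).
Proof. exact/theory_mp_ax/ax_A7. Qed.

Lemma theory_iff a b : T (a <==> b) <-> T (a ==> b) /\ T (b ==> a).
Proof. exact: theory_and. Qed.

Lemma theory_iffE a b : provable (a <==> b) -> (T a <-> T b).
Proof. by move=> /theory_ax /theory_iff [ab ba]; split; apply: theory_mp. Qed.

Lemma theory_negK a : T (~~ (~~ a)) <-> T a.
Proof. exact/theory_iffE/ax_A13. Qed.

Lemma theory_neg_and a b : T (~~ (a && b)) <-> T (~~ a || ~~ b).
Proof. exact/theory_iffE/ax_A15. Qed.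

Lemma theory_equ a b : provable (a === b) ->
  (T a <-> T b) /\ (T (~~ a) <-> T (~~ b)).
Proof.
by move=> /theory_ax /theory_and[/theory_iff[ab ba] /theory_iff[nab nba]];
  split; split; apply: theory_mp.
Qed.

End Theory.

(** The deduction theorem turned into a definition: if [T] is a theory, this is the least theory
    containing [T] and [c]. *)
Definition extend T c : form P N -> Prop := fun a => T (c ==> a).

Lemma theory_extend T c : theory T -> theory (extend T c).
Proof.
move=> thT; split=> [a /(theory_ax thT)|a b]; first exact: theory_weaken.
move=> cab; apply: (theory_mp thT).
exact: (theory_mp_ax thT (ax_A2 _ _ _)) cab.
Qed.

Lemma extend_sub T c : theory T -> forall a, T a -> extend T c a.
Proof. by move=> thT a; exact: theory_weaken. Qed.

Lemma extend_mem T c : theory T -> extend T c c.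
Proof. by move=> thT; exact: theory_imp_refl. Qed.

Lemma theory_or_elim T a b c : theory T ->
  extend T a c -> extend T b c -> T (a || b) -> T c.
Proof.
move=> thT ac bc; apply: (theory_mp thT); apply: (theory_mp thT) bc.
exact: (theory_mp_ax thT (ax_A8 _ _ _)) ac.
Qed.

Lemma theory_cases T a c : theory T ->
  extend T a c -> extend T (~~ a) c -> T c.
Proof.
move=> thT ac nac; apply: (theory_or_elim thT ac nac).
by apply: theory_ax; last exact: ax_A10.
Qed.

(** A12 gives one direction. For the other, split on [Bul a]: its negation is [Circ a], under which
    A11 derives anything from [a] and [~~ a]. *)
Lemma theory_bul T a : theory T -> (T (Bul a) <-> T a /\ T (~~ a)).
Proof.
move=> thT; split=> [/(theory_mp_ax thT (ax_A12 a)) /(theory_and thT)//|[Ta Tna]].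
have thE := theory_extend (Circ a) thT; apply: (theory_cases (a := Bul a) thT).
  exact: extend_mem.
apply: (theory_mp thE); last exact: (extend_sub _ thT Tna).
apply: (theory_mp thE); last exact: (extend_sub _ thT Ta).
by apply: (theory_mp_ax thE); [exact: ax_A11|exact: extend_mem].
Qed.

Lemma theory_circ_explode T a c : theory T ->
  T (Circ a) -> T a -> T (~~ a) -> T c.
Proof.
move=> thT oa Ta; apply: (theory_mp thT); apply: (theory_mp thT) Ta.
exact: (theory_mp_ax thT (ax_A11 _ _)) oa.
Qed.

Lemma theory_explode T a c : theory T -> T (StrongNeg a) -> T a -> T c.
Proof.
by move=> thT /(theory_and thT)[na oa] Ta; exact: theory_circ_explode oa Ta na.
Qed.

(** Under [a] the hypothesis applies. Under [~~ a], split on [Bul a]: it yields [a], and its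
    negation supplies the missing conjunct [Circ a]. *)
Lemma theory_strong_neg_intro T a : theory T ->
  T (a ==> StrongNeg a) -> T (StrongNeg a).
Proof.
move=> thT aTna; apply: (theory_cases (a := a)) => //.
have thE := theory_extend (~~ a) thT; apply: (theory_cases (a := Bul a)) => //.
  have thE' := theory_extend (Bul a) thE.
  have [Ta _] := (theory_bul a thE').1 (extend_mem _ thE).
  by apply: (theory_mp thE') Ta; do 2!apply: extend_sub => //.
have thE' := theory_extend (Circ a) thE.
apply/(theory_and thE'); split; last exact: extend_mem.
by apply: extend_sub => //; exact: extend_mem.
Qed.

(** A9 leaves [a] or [a ==> StrongNeg a], and the latter collapses to [StrongNeg a]. *)
Lemma theory_strong_em T a : theory T -> T (a || StrongNeg a).
Proof.
move=> thT; apply: (theory_or_elim thT) (theory_ax thT (ax_A9 a (StrongNeg a))).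
  by apply: theory_orl; [exact: theory_extend|exact: extend_mem].
have thE := theory_extend (a ==> StrongNeg a) thT.
apply: theory_orr => //; apply: theory_strong_neg_intro => //.
exact: extend_mem.
Qed.

Lemma theory_strong_cases T a c : theory T ->
  extend T a c -> extend T (StrongNeg a) c -> T c.
Proof.
move=> thT ac nac; apply: (theory_or_elim thT ac nac).
exact: theory_strong_em.
Qed.

(** * Theories maximal on a finite list and the Lindenbaum lemma *)

Definition consistent T : Prop := exists c, ~ T c.

(** Deciding only a finite list of formulas makes the extension lemma a plain induction on that
    list. *)
Definition maximal_on L T : Prop :=
  [/\ theory T, consistent T & forall a, List.In a L -> T a \/ T (StrongNeg a)].

Lemma lindenbaum L T : theory T -> consistent T ->
  exists2 T', maximal_on L T' & forall a, T a -> T' a.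
Proof.
elim: L T => [|x L IH] T thT cT; first by exists T => //; split.
have step c : consistent (extend T c) -> (c = x \/ c = StrongNeg x) ->
    exists2 T', maximal_on (x :: L) T' & forall a, T a -> T' a.
  move=> cE xc; have [T' [thT' cT' dT'] sub] := IH _ (theory_extend c thT) cE.
  have T'c : T' c by apply: sub; exact: extend_mem.
  exists T'; last by move=> a Ta; apply: sub; exact: extend_sub.
  split=> // a /= [<-|/dT'//].
  by case: xc T'c => ->; [left|right].
have [|ncx] := pselect (consistent (extend T x)); first by move/step; apply; left.
(* Adding [x] gives every formula, so by cases on [x] a formula missed by [T] is still missed after
   adding [StrongNeg x]. *)
apply: (step (StrongNeg x)); last by right.
case: cT => c nTc; exists c => Enc; apply: nTc.
apply: (theory_strong_cases thT) Enc.
by apply: contrapT => nc; apply: ncx; exists c.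
Qed.

Section Maximal.
Variables (L : seq (form P N)) (T : form P N -> Prop) (mT : maximal_on L T).

Let thT : theory T. Proof. by case: mT. Qed.

Lemma maximal_strong_neg a : List.In a L -> (T (StrongNeg a) <-> ~ T a).
Proof.
case: mT => _ [c nc] dT aL; split=> [na Ta|nTa].
  exact/nc/(theory_explode _ thT na).
by case: (dT _ aL).
Qed.

Lemma maximal_imp a b : List.In a L -> (T (a ==> b) <-> (T a -> T b)).
Proof.
move=> aL; split=> [|ab]; first exact: theory_mp.
have [Ta|/(maximal_strong_neg aL) na] := pselect (T a).
  exact/(theory_weaken thT)/ab.
by apply: theory_orl.
Qed.

Lemma maximal_or a b : List.In a L -> (T (a || b) <-> T a \/ T b).
Proof.
move=> aL; split=> [|[]]; [|exact: theory_orl|exact: theory_orr].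
move=> ab; have [Ta|/(maximal_strong_neg aL) na] := pselect (T a).
  by left.
right.
apply: (theory_or_elim thT) (extend_mem b thT) ab.
apply: (theory_explode _ (theory_extend a thT)); last exact: extend_mem.
exact: extend_sub.
Qed.

Lemma maximal_neg a : List.In a L -> ~ T a -> T (~~ a).
Proof. by move=> aL /(maximal_strong_neg aL) /(theory_and thT)[]. Qed.

Lemma maximal_circ a : List.In (Bul a) L -> (T (Circ a) <-> ~ (T a /\ T (~~ a))).
Proof.
move=> aL; split=> [oa [Ta Tna]|nba].
  by case: mT => _ [c nc] _; apply: nc; exact: (theory_circ_explode _ thT oa).
by apply: maximal_neg => // /(theory_bul _ thT).
Qed.

End Maximal.

Lemma maximal_provable L a :
  (forall T, maximal_on (a :: L) T -> T a) -> provable a.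
Proof.
move=> Ha; apply: contrapT => nPa.
have thE := theory_extend (StrongNeg a) theory_provable.
have [|T mT sub] := @lindenbaum (a :: L) _ thE.
  exists a => Ea; apply: nPa.
  apply: (theory_strong_cases theory_provable) Ea.
  exact: (theory_imp_refl theory_provable).
have /(maximal_strong_neg mT) := sub _ (extend_mem _ theory_provable).
apply; first by left.
exact: Ha.
Qed.

(** Maximality on a suitable finite list turns the connectives under [T] into
    those of the metalanguage, and provable equivalences into tautologies. *)
Lemma maximal_equ L a b :
  (forall T, maximal_on L T -> (T a <-> T b) /\ (T (~~ a) <-> T (~~ b))) ->
  provable (a === b).
Proof.
move=> ab; apply: (@maximal_provable [:: a, b, ~~ a, ~~ b & L]) => T mT.
have [thT cT dT] := mT.
have [|TabE TnabE] := ab T; first by split=> // c cL; apply: dT; do 5!right.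
apply/(theory_and thT); split; apply/(theory_iff thT); split;
  by apply/(maximal_imp mT) => /=; tauto.
Qed.

(** * Provable equivalence as a congruence *)

Lemma equ_refl a : provable (a === a).
Proof. by apply: (@maximal_equ [::]). Qed.

Lemma equ_trans a b c :
  provable (a === b) -> provable (b === c) -> provable (a === c).
Proof.
move=> ab bc; apply: (@maximal_equ [::]) => T [thT _ _].
by have := theory_equ thT ab; have := theory_equ thT bc; tauto.
Qed.

Lemma equ_negK a : provable (a === ~~ (~~ a)).
Proof.
by apply: (@maximal_equ [::]) => T [thT _ _]; rewrite !(theory_negK thT).
Qed.

Lemma equ_neg a b : provable (a === b) -> provable (~~ a === ~~ b).
Proof.
move=> ab; apply: (@maximal_equ [::]) => T [thT _ _].
by have := theory_equ thT ab; rewrite !(theory_negK thT); tauto.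
Qed.

Lemma equ_bul a b : provable (a === b) -> provable (Bul a === Bul b).
Proof.
move=> ab; apply: (@maximal_equ [:: Bul a; Bul b]) => T mT.
have [thT _ _] := mT; have := theory_equ thT ab.
rewrite !(theory_bul _ thT) -/(Circ a) -/(Circ b).
by rewrite (maximal_circ mT (a := a)) ?(maximal_circ mT (a := b)) /=; tauto.
Qed.

Lemma equ_and a a' b b' : provable (a === a') -> provable (b === b') ->
  provable (a && b === a' && b').
Proof.
move=> aa' bb'; apply: (@maximal_equ [:: ~~ a; ~~ a']) => T mT.
have [thT _ _] := mT; have := theory_equ thT aa'; have := theory_equ thT bb'.
rewrite (theory_neg_and thT a) (theory_neg_and thT a') !(theory_and thT).
by rewrite (maximal_or mT (a := ~~ a)) ?(maximal_or mT (a := ~~ a')) /=; tauto.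
Qed.

(** No formula is its own immediate subformula, so RE with [a === b] rewrites
    [Know i a] exactly into [Know i b], and likewise for updates. *)
Fixpoint height a : nat :=
  match a with
  | Var _ => 0
  | Neg b => (height b).+1
  | Bul b => (height b).+1
  | And b c => (height b + height c).+1
  | Know _ b => (height b).+1
  | Upd _ _ _ b => (height b).+1
  end.

Lemma replace_all_id t g : replace_all t g t = g.
Proof. by case: t => *; rewrite /= asboolT. Qed.

Lemma equ_know i a b : provable (a === b) -> provable (Know i a === Know i b).
Proof.
move=> /(rule_RE (Know i a)) /=; rewrite asboolF ?replace_all_id //.
by move=> /(congr1 height) /= /esym /n_Sn.
Qed.

Lemma equ_upd (U : action_frame N) (pre : U -> form P N) (e : U) a b :
  provable (a === b) -> provable (Upd U pre e a === Upd U pre e b).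
Proof.
move=> /(rule_RE (Upd U pre e a)) /=; rewrite asboolF ?replace_all_id //.
by move=> /(congr1 height) /= /esym /n_Sn.
Qed.

End Hilbert.

(** * Reduction to static formulas *)

Section Semantics.
Import Order.TTheory.
Local Open Scope order_scope.
Variables (P N : Type).
Implicit Types (a b c d : form P N) (M : kripke P N).

Lemma tvP (v : 'I_3) : [\/ v = tv0, v = tvhalf | v = tv1].
Proof.
case: v => [[|[|[|//]]] lt_v].
- by constructor 1; exact: val_inj.
- by constructor 2; exact: val_inj.
- by constructor 3; exact: val_inj.
Qed.

(** A nonempty set of truth values has a least element, which is then its infimum; for the empty set
    the default [tv1] is the top element. *)
Lemma le_infimum_tv (A : set 'I_3) (v : 'I_3) :
  v <= infimum tv1 A <-> forall x, A x -> v <= x.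
Proof.
have [->|/set0P[x Ax]] := eqVneq A set0.
  rewrite /infimum eqxx; split=> // _; by case: (tvP v) => ->.
have [m Am leA] : exists2 m, A m & forall y, A y -> m <= y.
  case: (@arg_minP _ _ _ x (fun y => `[< A y >]) id) => [|m /asboolP Am lem].
    exact/asboolP.
  by exists m => // y Ay; apply: lem; apply/asboolP.
have infE : infimum tv1 A = m.
  rewrite /infimum ifF; last by apply/negbTE/set0P; exists x.
  apply: xget_unique; first by split=> // y; exact.
  move=> y [lby uby]; apply: le_anti; rewrite lby //=; exact: uby.
rewrite infE; split=> [vm y /leA|]; [exact: le_trans|exact].
Qed.

Lemma le_eval_know M (s : M) i a (v : 'I_3) :
  v <= eval (Know i a) s <-> forall t, acc i s t -> v <= eval a t.
Proof.
rewrite le_infimum_tv; split=> [va t st|va _ [t st <-]]; last exact: va.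
by apply: va; exists t.
Qed.

Lemma eq_by_le (u w : 'I_3) : (forall v : 'I_3, v <= u <-> v <= w) -> u = w.
Proof. by move=> uw; apply: le_anti; rewrite (uw u).1 // (uw w).2. Qed.

Lemma eval_know_ext M (s : M) i a b :
  (forall t : M, eval a t = eval b t) -> eval (Know i a) s = eval (Know i b) s.
Proof.
move=> ab; apply: eq_by_le => v; rewrite !le_eval_know.
by split=> va t st; [rewrite -ab|rewrite ab]; exact: va.
Qed.

(** [StrongNeg a] has value [tv0] if [a] is designated and [tv1] otherwise. The resulting
    conditional has the shape of the [Upd] clause of [eval]. *)
Lemma eval_imp M (s : M) a b :
  eval (a ==> b) s = if designated (eval a s) then eval b s else tv1.
Proof.
by rewrite /=; case: (tvP (eval a s)) => ->; case: (tvP (eval b s)) => ->;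
  apply: val_inj; rewrite /= ?minEle.
Qed.

Lemma eval_updE M (s : M) (U : action_frame N) (pre : U -> form P N) (e : U) b c :
  (designated (eval (pre e) s) ->
   forall x : update (fun t f => designated (eval (pre f) t)),
     sval x = (s, e) -> eval b x = eval c s) ->
  eval (Upd U pre e b) s = eval (pre e ==> c) s.
Proof.
move=> bc; rewrite eval_imp /=.
case: insubP => [x /= Des xE|/negbTE /= Des]; rewrite Des //.
exact: bc.
Qed.

Lemma eval_upd_at M (U : action_frame N) (pre : U -> form P N)
    (x : update (fun (t : M) f => designated (eval (pre f) t))) b :
  eval (Upd U pre (sval x).2 b) (sval x).1 = eval b x.
Proof.
rewrite /=; case: insubP => [y _ yE|]; last by case: x => -[t f] /= Dtf /negP[].
suff -> : y = x by [].
by apply: val_inj; rewrite yE; exact: esym (surjective_pairing (sval x)).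
Qed.

Lemma le_eval_bigAnd M (s : M) d b l (v : 'I_3) :
  v <= eval (bigAnd d (b :: l)) s <->
  forall c, List.In c (b :: l) -> v <= eval c s.
Proof.
rewrite /=; elim: l b => [|c l IH] b /=.
  by split=> [vb _ [<-//|[]]|]; apply; left.
rewrite IH; split=> [vl|vl c' [<-|c'l]].
- have := vl _ (or_introl erefl); rewrite /= le_min => /andP[vb vc].
  by move=> c' [<-|[<-|c'l]] //; apply: vl; right.
- by rewrite /= le_min !vl //=; tauto.
- by apply: vl; tauto.
Qed.

End Semantics.

Lemma In_mem (T : eqType) (x : T) (l : seq T) : List.In x l <-> x \in l.
Proof.
elim: l => //= y l IH; rewrite inE IH; split=> [[->|->]|/orP[/eqP->|]].
- by rewrite eqxx.
- by rewrite orbT.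
- by left.
- by right.
Qed.

Lemma In_map (T T' : Type) (f : T -> T') (l : seq T) (y : T') :
  List.In y (map f l) <-> exists2 x, List.In x l & f x = y.
Proof.
elim: l => [|x l IH] /=; first by split=> [|[]].
rewrite IH; split=> [[<-|[z zl <-]]|[z [->|zl] <-]].
- by exists x; first left.
- by exists z; first right.
- by left.
- by right; exists z.
Qed.

(** * Reduction axioms and static normal forms *)

Section Reduction.
Import Order.TTheory.
Local Open Scope order_scope.
Variables (P N : Type).
Implicit Types (a b c d : form P N) (M : kripke P N).

Fixpoint static a : Prop :=
  match a with
  | Var _ => True
  | Neg b | Bul b | Know _ b => static b
  | And b c => static b /\ static c
  | Upd _ _ _ _ => False
  end.

(** The semantic half carries validity from a formula to its static form, the provable half carries
    provability back. *)
Definition equivalent a b : Prop :=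
  provable (a === b) /\ forall M (s : M), eval a s = eval b s.

Lemma equivalent_trans a b c : equivalent a b -> equivalent b c -> equivalent a c.
Proof.
move=> [pab ab] [pbc bc]; split=> [|M s]; first exact: equ_trans pbc.
by rewrite ab.
Qed.

Lemma equivalent_neg a b : equivalent a b -> equivalent (~~ a) (~~ b).
Proof. by move=> [pab ab]; split=> [|M s /=]; [exact: equ_neg|rewrite ab]. Qed.

Lemma equivalent_bul a b : equivalent a b -> equivalent (Bul a) (Bul b).
Proof. by move=> [pab ab]; split=> [|M s /=]; [exact: equ_bul|rewrite ab]. Qed.

Lemma equivalent_and a a' b b' :
  equivalent a a' -> equivalent b b' -> equivalent (a && b) (a' && b').
Proof.
move=> [paa' aa'] [pbb' bb']; split=> [|M s /=]; first exact: equ_and.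
by rewrite aa' bb'.
Qed.

Lemma equivalent_know i a b : equivalent a b -> equivalent (Know i a) (Know i b).
Proof.
by move=> [pab ab]; split=> [|M s]; [exact: equ_know|apply: eval_know_ext].
Qed.

Lemma equivalent_upd (U : action_frame N) (pre : U -> form P N) (e : U) a b :
  equivalent a b -> equivalent (Upd U pre e a) (Upd U pre e b).
Proof.
move=> [pab ab]; split=> [|M s /=]; first exact: equ_upd.
by case: insubP.
Qed.

Definition reducible a : Prop := exists2 b, static b & equivalent a b.

Lemma reducible_static a : static a -> reducible a.
Proof. by move=> sa; exists a => //; split=> //; exact: equ_refl. Qed.

Lemma reducible_equivalent a b : equivalent a b -> reducible b -> reducible a.
Proof. by move=> ab [c sc bc]; exists c => //; apply: equivalent_trans bc. Qed.

Lemma reducible_neg a : reducible a -> reducible (~~ a).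
Proof. by move=> [b sb ab]; exists (~~ b) => //; exact: equivalent_neg. Qed.

Lemma reducible_bul a : reducible a -> reducible (Bul a).
Proof. by move=> [b sb ab]; exists (Bul b) => //; exact: equivalent_bul. Qed.

Lemma reducible_and a b : reducible a -> reducible b -> reducible (a && b).
Proof.
move=> [a' sa' aa'] [b' sb' bb']; exists (a' && b') => //.
exact: equivalent_and.
Qed.

Lemma reducible_know i a : reducible a -> reducible (Know i a).
Proof. by move=> [b sb ab]; exists (Know i b) => //; exact: equivalent_know. Qed.

Lemma reducible_imp a b : reducible a -> reducible b -> reducible (a ==> b).
Proof.
move=> ra rb.
by do ![exact: ra|exact: rb|apply: reducible_neg|apply: reducible_bul
       |apply: reducible_and].
Qed.

Lemma reducible_bigAnd d l :
  reducible d -> (forall a, List.In a l -> reducible a) -> reducible (bigAnd d l).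
Proof.
move=> rd; case: l => [//|a l] /= rl.
have: reducible a by apply: rl; left.
have {rl}: forall b, List.In b l -> reducible b by move=> b bl; apply: rl; right.
elim: l a => //= b l IH a rl ra; apply: IH => [c cl|]; first by apply: rl; right.
by apply: reducible_and => //; apply: rl; left.
Qed.

Section Update.
Variables (U : action_frame N) (pre : U -> form P N).

Lemma equivalent_upd_var (e : U) p :
  equivalent (Upd U pre e (Var p)) (pre e ==> Var p).
Proof.
split=> [|M s]; first exact: ax_AM1.
by apply: eval_updE => Des x /= ->.
Qed.

Lemma eval_upd_state M (s : M) (e : U) b
    (x : update (fun (t : M) f => designated (eval (pre f) t))) :
  sval x = (s, e) -> eval (Upd U pre e b) s = eval b x.
Proof. by move=> xE; rewrite -eval_upd_at xE. Qed.

Lemma equivalent_upd_neg (e : U) a :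
  equivalent (Upd U pre e (~~ a)) (pre e ==> ~~ Upd U pre e a).
Proof.
split=> [|M s]; first exact: ax_AM2.
by apply: eval_updE => Des x xE; rewrite [LHS]/= -(eval_upd_state _ xE).
Qed.

Lemma equivalent_upd_bul (e : U) a :
  equivalent (Upd U pre e (Bul a)) (pre e ==> Bul (Upd U pre e a)).
Proof.
split=> [|M s]; first exact: ax_AM3.
by apply: eval_updE => Des x xE; rewrite [LHS]/= -(eval_upd_state _ xE).
Qed.

Lemma equivalent_upd_and (e : U) a b :
  equivalent (Upd U pre e (a && b)) (Upd U pre e a && Upd U pre e b).
Proof.
split=> [|M s /=]; first exact: ax_AM4.
by case: insubP => // _; rewrite minxx.
Qed.

(** Where [pre e] is designated, the left side is an infimum over the related pairs [(t, f)] of the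
    updated model, the right side one over all [t] and [f] related to [s] and [e]. A pair absent
    from the updated model contributes only [tv1]. *)
Lemma equivalent_upd_know (e : U) i a :
  equivalent (Upd U pre e (Know i a)) (pre e ==> bigKnow pre i e a).
Proof.
split=> [|M s]; first exact: ax_AM5.
apply: eval_updE => Des x xE; apply: eq_by_le => v.
(* By reflexivity the list of conjuncts is nonempty, so [bigAnd] does not take its default value. *)
have ee : e \in [seq f <- enum U | indist i e f].
  by rewrite mem_filter mem_enum; have [->] := indist_equiv i e e e.
rewrite le_eval_know /bigKnow.
have memE f : indist i e f <-> f \in [seq f <- enum U | indist i e f].
  by rewrite mem_filter mem_enum inE andbT.
move: ee memE; case: [seq f <- enum U | indist i e f] => // f0 fs ee memE.
rewrite [map _ _]/= le_eval_bigAnd.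
rewrite -[_ :: _]/[seq Know i (Upd U pre f a) | f <- f0 :: fs].
split=> [va c /In_map[f ffs <-]|va y xy].
  rewrite le_eval_know => t st.
  have ief : indist i e f by apply/memE/In_mem.
  case Dtf : (designated (eval (pre f) t)).
    pose y : update (fun (t : M) f => designated (eval (pre f) t)) :=
      exist _ (t, f) Dtf.
    rewrite (eval_upd_state a (erefl : sval y = (t, f))); apply: va.
    by split; rewrite xE.
  by rewrite /= insubF //; case: (tvP v) => ->.
rewrite -eval_upd_at.
have [xyM xyU] := xy; rewrite xE /= in xyM xyU.
have := va (Know i (Upd U pre (sval y).2 a)).
rewrite le_eval_know; apply=> //; apply/In_map.
by exists (sval y).2 => //; apply/In_mem/memE.
Qed.

Hypothesis reducible_pre : forall f, reducible (pre f).

(** The action [e] stays quantified in the induction on [b], because AM5 passes to all actions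
    related to [e]. *)
Lemma reducible_upd_static b : static b -> forall e, reducible (Upd U pre e b).
Proof.
elim: b => [p|b IH|b IH|b IHb c IHc|i b IH|] //=.
- move=> _ e; apply: reducible_equivalent (equivalent_upd_var e p) _.
  by apply: reducible_imp => //; exact: reducible_static.
- move=> /IH rb e; apply: reducible_equivalent (equivalent_upd_neg e b) _.
  exact/reducible_imp/reducible_neg.
- move=> /IH rb e; apply: reducible_equivalent (equivalent_upd_bul e b) _.
  exact/reducible_imp/reducible_bul.
- move=> [/IHb rb /IHc rc] e.
  apply: reducible_equivalent (equivalent_upd_and e b c) _.
  exact: reducible_and.
move=> sb e; apply: reducible_equivalent (equivalent_upd_know e i b) _.
apply: reducible_imp => //; apply: reducible_bigAnd.
  exact: reducible_static.
by move=> _ /In_map[f _ <-]; apply/reducible_know/IH.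
Qed.

End Update.

Lemma reduction a : reducible a.
Proof.
elim: a => [p|a IH|a IH|a IHa b IHb|i a IH|U pre IHpre e a [b sb ab]].
- exact: reducible_static.
- exact: reducible_neg.
- exact: reducible_bul.
- exact: reducible_and.
- exact: reducible_know.
apply: reducible_equivalent (equivalent_upd pre e ab) _.
exact: reducible_upd_static.
Qed.

End Reduction.

(** * Modal reasoning *)

Section Modal.
Variables (P N : Type).
Implicit Types (a b c d : form P N) (T : form P N -> Prop) (L : seq (form P N)).

Definition known T i : form P N -> Prop := fun a => T (Know i a).

(** Nec and K give the two closure conditions, so that reasoning under [Know i] becomes reasoning in
    a theory. *)
Lemma theory_known T i : theory T -> theory (known T i).
Proof.
move=> thT; split=> [a pa|a b]; first exact/(theory_ax thT)/rule_Nec.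
by move=> kab; apply: (theory_mp thT); exact: (theory_mp_ax thT (ax_K _ _ _)) kab.
Qed.

(** Instantiated at [extend provable a]. Implications proved this way can be applied under
    [Know i]. *)
Lemma theory_imp_provable a b :
  (forall T, theory T -> T a -> T b) -> provable (a ==> b).
Proof.
have thP := @theory_provable P N.
move=> ab; apply: (ab (extend provable a)); first exact: theory_extend.
exact: extend_mem.
Qed.

Lemma theory_strong_negK T a : theory T -> (T (StrongNeg (StrongNeg a)) <-> T a).
Proof.
move=> thT; split=> [nna|Ta].
  apply: (theory_strong_cases (a := a)) => //; first exact: extend_mem.
  apply: (theory_explode (a := StrongNeg a)).
  - exact: theory_extend.
  - exact: extend_sub.
  - exact: extend_mem.
apply: theory_strong_neg_intro => //.
apply: (theory_explode (T := extend T _) (a := a)); last exact: extend_sub.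
  exact: theory_extend.
exact: extend_mem.
Qed.

Section Theory.
Variables (T : form P N -> Prop) (thT : theory T) (i : N).

Lemma theory_know_mono a b : provable (a ==> b) -> T (Know i a) -> T (Know i b).
Proof. by move=> ab; apply: (theory_mp_ax (theory_known i thT) ab). Qed.

(** The two sides differ by a double negation under [Know i], which RE removes. *)
Lemma theory_neg_know a : T (~~ Know i a) <-> T (Poss i (~~ a)).
Proof. exact: (theory_equ thT (equ_know i (equ_negK a))).2. Qed.

(** Under [Know i], [StrongNeg a] makes [a] imply any formula, in particular [Know i c]. K1 then
    gives [Poss i (Know i c)], which 5' and T bring down to [c]. *)
Lemma theory_poss_explode a c : T (Poss i a) -> T (Know i (StrongNeg a)) -> T c.
Proof.
have thK := theory_known i thT => pa kna.
have : T (Know i (a ==> Know i c)).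
  apply: (theory_explode _ (theory_extend a thK)); last exact: extend_mem.
  exact: extend_sub.
move=> /(theory_mp_ax thT (ax_K1 _ _ _)) /(theory_mp thT) /(_ pa).
by move=> /(theory_mp_ax thT (ax_5' _ _)); apply: (theory_mp_ax thT); exact: ax_T.
Qed.

(** [Poss i a] explodes, hence implies [Know i (StrongNeg a)]. K3 turns this into
    [Know i (a ==> StrongNeg a)], which collapses under [Know i]. *)
Lemma theory_know_strong_neg a :
  T (StrongNeg (Poss i a)) -> T (Know i (StrongNeg a)).
Proof.
move=> npa; apply: (theory_strong_neg_intro (theory_known i thT)).
apply: (theory_mp_ax thT (ax_K3 i a (StrongNeg a))).
apply: (theory_explode _ (theory_extend (Poss i a) thT)); last exact: extend_mem.
exact: extend_sub.
Qed.

End Theory.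

Lemma theory_know_strong_negK T i a : theory T ->
  (T (Know i (StrongNeg (StrongNeg a))) <-> T (Know i a)).
Proof. by move=> thT; exact: theory_strong_negK (theory_known i thT). Qed.

Lemma poss_strong_neg i a :
  provable (Poss i (StrongNeg a) ==> StrongNeg (Know i a)).
Proof.
apply: theory_imp_provable => T thT pna.
apply: (theory_strong_neg_intro thT); have thE := theory_extend (Know i a) thT.
apply: (theory_poss_explode thE _ (extend_sub _ thT pna)).
by apply/(theory_know_strong_negK i a thE); exact: extend_mem.
Qed.

Lemma know_strong_neg i a :
  provable (Know i (StrongNeg a) ==> StrongNeg (Poss i a)).
Proof.
apply: theory_imp_provable => T thT kna.
apply: (theory_strong_neg_intro thT); have thE := theory_extend (Poss i a) thT.
apply: (theory_poss_explode thE _ (extend_mem _ thT)); exact: extend_sub.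
Qed.

(** * Introspection for knowledge and both of its negations *)

Section Introspection.
Variables (T : form P N -> Prop) (thT : theory T) (i : N) (a : form P N).

Lemma introspection_know : T (Know i a) -> T (Know i (Know i a)).
Proof. exact/(theory_mp_ax thT)/ax_4. Qed.

(** Split on [Poss i (StrongNeg a)]. If it holds, 5 makes it known, and it implies
    [StrongNeg (Know i a)]. Otherwise cancelling two strong negations gives [Know i a], a
    contradiction. *)
Lemma introspection_not_know :
  T (StrongNeg (Know i a)) -> T (Know i (StrongNeg (Know i a))).
Proof.
move=> nka; apply: (theory_strong_cases (a := Poss i (StrongNeg a)) thT).
  apply: (theory_know_mono (theory_extend _ thT) (poss_strong_neg i a)).
  apply: (theory_mp_ax (theory_extend _ thT) (ax_5 _ _)); exact: extend_mem.
have thE := theory_extend (StrongNeg (Poss i (StrongNeg a))) thT.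
apply: (theory_explode _ thE (extend_sub _ thT nka)).
apply/(theory_know_strong_negK i a thE)/(theory_know_strong_neg thE).
exact: extend_mem.
Qed.

Lemma introspection_neg_know : T (~~ Know i a) -> T (Know i (~~ Know i a)).
Proof.
move=> /(theory_neg_know thT) /(theory_mp_ax thT (ax_5 _ _)).
apply: (theory_know_mono thT).
by apply: theory_imp_provable => T' thT' /(theory_neg_know thT' i a).2.
Qed.

Lemma introspection_not_neg_know :
  T (StrongNeg (~~ Know i a)) -> T (Know i (StrongNeg (~~ Know i a))).
Proof.
(* The equivalence of [~~ Know i a] and [Poss i (~~ a)] passes to their strong negations by
   contraposition, since [StrongNeg] is a classical negation. *)
move=> nnk; have nnp T' : theory T' ->
    T' (StrongNeg (Poss i (~~ a))) -> T' (StrongNeg (~~ Know i a)).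
  move=> thT' np; apply: (theory_strong_neg_intro thT').
  have thE := theory_extend (~~ Know i a) thT'.
  apply: (theory_explode _ thE (extend_sub _ thT' np)).
  by apply: (theory_neg_know thE i a).1; exact: extend_mem.
have /(theory_know_strong_neg thT) : T (StrongNeg (Poss i (~~ a))).
  apply: (theory_strong_neg_intro thT).
  have thE := theory_extend (Poss i (~~ a)) thT.
  apply: (theory_explode _ thE (extend_sub _ thT nnk)).
  by apply: (theory_neg_know thE i a).2; exact: extend_mem.
move=> /(theory_mp_ax thT (ax_4 _ _)); apply: (theory_know_mono thT).
apply: theory_imp_provable => T' thT' /(theory_mp_ax thT' (know_strong_neg _ _)).
exact: nnp.
Qed.

End Introspection.
End Modal.

(** * The canonical model *)

Section Canonical.
Import Order.TTheory.
Local Open Scope order_scope.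
Variables (P N : Type).
Implicit Types (a b c d : form P N) (T : form P N -> Prop) (L : seq (form P N)).

Definition value T a : 'I_3 :=
  if `[< T a >] then if `[< T (Neg a) >] then tvhalf else tv1 else tv0.

Lemma designated_value T a : designated (value T a) <-> T a.
Proof. by rewrite /value; do ?case: asboolP => ?. Qed.

Lemma le_half_value T a : tvhalf <= value T a <-> T a.
Proof. by rewrite /value; do ?case: asboolP => ?. Qed.

Lemma le_one_value T a : T a \/ T (Neg a) -> (tv1 <= value T a <-> ~ T (Neg a)).
Proof. by rewrite /value; do ?case: asboolP => ?; split=> //; tauto. Qed.

(** Membership of [~~ a] separates [tvhalf] from [tv1], so negations are decided as well. *)
Definition negations L : seq (form P N) := L ++ [seq ~~ a | a <- L].

Lemma In_cat (A : Type) (x : A) (l l' : seq A) :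
  List.In x (l ++ l') <-> List.In x l \/ List.In x l'.
Proof. by elim: l => [|y l IH] /=; tauto. Qed.

Lemma In_negations L a : List.In a L ->
  List.In a (negations L) /\ List.In (~~ a) (negations L).
Proof.
by move=> aL; split; apply/In_cat; [left|right; apply/In_map; exists a].
Qed.

Section Model.
Variables (Phi : seq (form P N)) (a0 : form P N).

Definition complete T := maximal_on (negations Phi) T.

Definition position a : nat := find (fun b => `[< b = a >]) Phi.

(** Only the values on [Phi] are prescribed, so several theories may realize one [X]; [truth] is
    stated for each of them. *)
Definition realizes (X : nat -> 'I_3) T : Prop :=
  complete T /\ forall a, List.In a Phi -> X (position a) = value T a.

Lemma realizes_value T :
  complete T -> realizes (fun k => value T (nth a0 Phi k)) T.
Proof.
move=> cT; split=> // a aPhi; congr value.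
have : has (fun b => `[< b = a >]) Phi.
  elim: Phi aPhi => //= b L IH [->|/IH->]; first by rewrite asboolT.
  by rewrite orbT.
by move=> /(nth_find a0) /asboolP.
Qed.

(** States are sequences of truth values and not theories, because [image] in
    [eval] bounds the universe of states strictly below that of [form]. *)
Definition canonical_state : Type := {X : nat -> 'I_3 | exists T, realizes X T}.

Definition canonical_point T (cT : complete T) : canonical_state :=
  exist (fun X => exists T, realizes X T) _ (ex_intro _ T (realizes_value cT)).

Definition canonical_acc i (X Y : canonical_state) : Prop :=
  forall a, List.In (Know i a) Phi ->
    sval X (position (Know i a)) = sval Y (position (Know i a)).

Lemma canonical_acc_equiv i : RelationClasses.Equivalence (canonical_acc i).
Proof.
split=> [X a //|X Y XY a aPhi|X Y Z XY YZ a aPhi]; first by rewrite XY.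
by rewrite XY // YZ.
Qed.

Definition canonical_model : kripke P N :=
  {| state := canonical_state;
     acc := canonical_acc;
     acc_equiv := canonical_acc_equiv;
     valuation := fun X p => sval X (position (Var p)) |}.

(** [T'] extends everything known in [T] together with [c]. Introspection carries [Know i a] and
    [~~ Know i a], or their strong negations, from [T] to [T'], which fixes the value of
    [Know i a]. *)
Lemma complete_successor T i c : complete T -> ~ T (Know i (StrongNeg c)) ->
  exists T', [/\ complete T', T' c &
    forall a, List.In (Know i a) Phi -> value T (Know i a) = value T' (Know i a)].
Proof.
move=> cT nknc; have [thT _ dT] := cT.
have thK := theory_known i thT; have thE := theory_extend c thK.
have [|T' cT' sub] := lindenbaum (negations Phi) thE.
  (* If [c] implied [StrongNeg c] under [Know i], then [StrongNeg c] would be known. *)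
  exists (StrongNeg c) => /(theory_strong_neg_intro thK); exact: nknc.
have T'K d : T (Know i d) -> T' d by move=> ?; apply: sub; exact: extend_sub.
exists T'; split=> //; first by apply: sub; exact: extend_mem.
move=> a /In_negations[kaL nkaL]; rewrite /value.
have -> : T (Know i a) = T' (Know i a).
  apply/propext; split=> [/(introspection_know thT)/T'K //|].
  case: (dT _ kaL) => // /(introspection_not_know thT)/T'K.
  by move=> /(maximal_strong_neg cT' kaL).
suff -> : T (~~ Know i a) = T' (~~ Know i a) by [].
apply/propext; split=> [/(introspection_neg_know thT)/T'K //|].
case: (dT _ nkaL) => // /(introspection_not_neg_know thT)/T'K.
by move=> /(maximal_strong_neg cT' nkaL).
Qed.

Fixpoint subformulas a : seq (form P N) :=
  a :: match a with
       | Neg b | Bul b | Know _ b | Upd _ _ _ b => subformulas b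
       | And b c => subformulas b ++ subformulas c
       | Var _ => [::]
       end.

Lemma subformulas_self a : List.In a (subformulas a).
Proof. by case: a => *; left. Qed.

Lemma truth a :
  static a -> (forall b, List.In b (subformulas a) -> List.In b Phi) ->
  forall (X : canonical_model) T, realizes (sval X) T -> eval a X = value T a.
Proof.
elim: a => [p|a IH|a IH|a IHa b IHb|i a IH|//] sa sub X T rT; have [cT XT] := rT;
    have [thT [bot nbot] _] := cT.
- by rewrite /= XT //; apply: sub; left.
- have subs b : List.In b (subformulas a) -> List.In b Phi.
    by move=> ba; apply: sub; right.
  have [aL _] := In_negations (subs _ (subformulas_self a)).
  rewrite [LHS]/= (IH sa subs X T rT) /value (propext (theory_negK thT a)).
  have := maximal_neg cT aL.
  by do ?case: asboolP => ?; move=> ?; first [exact: val_inj|tauto].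
- have subs b : List.In b (subformulas a) -> List.In b Phi.
    by move=> ba; apply: sub; right.
  have [bL _] := In_negations (sub _ (subformulas_self (Bul a))).
  rewrite [LHS]/= (IH sa subs X T rT) /value (propext (theory_bul a thT)).
  rewrite -/(Circ a) (propext (maximal_circ cT bL)).
  by do ?case: asboolP => ?; first [done|tauto].
- have subsa c : List.In c (subformulas a) -> List.In c Phi.
    by move=> ca; apply: sub; right; apply/In_cat; left.
  have subsb c : List.In c (subformulas b) -> List.In c Phi.
    by move=> cb; apply: sub; right; apply/In_cat; right.
  have [aL naL] := In_negations (subsa _ (subformulas_self a)).
  have [bL nbL] := In_negations (subsb _ (subformulas_self b)).
  case: sa => sa sb; rewrite [LHS]/= (IHa sa subsa X T rT) (IHb sb subsb X T rT).
  have := maximal_neg cT aL; have := maximal_neg cT bL.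
  rewrite /value (propext (theory_and thT a b)).
  rewrite (propext (theory_neg_and thT a b)).
  rewrite (propext (maximal_or cT _ naL)) minEle.
  by do ?case: asboolP => ?; move=> ? ?; first [done|tauto].
have subs b : List.In b (subformulas a) -> List.In b Phi.
  by move=> ba; apply: sub; right.
have [aL naL] := In_negations (subs _ (subformulas_self a)).
have kaPhi := sub _ (subformulas_self (Know i a)).
have [kaL nkaL] := In_negations kaPhi.
have em T' b : complete T' -> List.In b (negations Phi) -> T' b \/ T' (~~ b).
  move=> cT' bL; have [|/(maximal_neg cT' bL)] := pselect (T' b); tauto.
have accE (Y : canonical_model) T' : acc i X Y -> realizes (sval Y) T' ->
    value T (Know i a) = value T' (Know i a).
  by move=> /(_ _ kaPhi) XY [_ YT']; rewrite -XT // XY YT'.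
have succ T' : complete T' ->
    (forall b, List.In (Know i b) Phi ->
      value T (Know i b) = value T' (Know i b)) ->
    exists2 Y : canonical_model, acc i X Y & realizes (sval Y) T'.
  move=> cT' TT'; have rT' := realizes_value cT'.
  exists (canonical_point cT') => // b kbPhi.
  by rewrite XT // TT' //; exact/esym/rT'.2.
(* The values are compared at each threshold: [tv0] is trivial, [tvhalf] asks that [a] belong to all
   successors, [tv1] that [~~ a] belong to none. *)
apply: eq_by_le => v; rewrite le_eval_know.
have [->|->|->] := tvP v; first by split.
- rewrite le_half_value; split=> [all|ka Y XY].
    apply: contrapT => nka; have [|T' [cT' T'na /(succ _ cT')[Y XY rY]]] :=
      complete_successor (i := i) (c := StrongNeg a) cT.
      by move=> /(theory_know_strong_negK _ _ thT).
    have := all Y XY; rewrite (IH sa subs Y T' rY) le_half_value.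
    exact/(maximal_strong_neg cT').
  have [T' rT'] := svalP Y; rewrite (IH sa subs Y T' rT') le_half_value.
  have [[thT' _ _] _] := rT'; apply: (theory_mp_ax thT' (ax_T i a)).
  by apply/le_half_value; rewrite -(accE Y T' XY rT'); apply/le_half_value.
rewrite le_one_value; last exact: em.
split=> [all nka|nnka Y XY].
  (* [~~ Know i a] amounts to [Poss i (~~ a)], so some successor contains [~~ a], and there [a] is
     below [tv1]. *)
  have [|T' [cT' T'na /(succ _ cT')[Y XY rY]]] :=
      complete_successor (i := i) (c := ~~ a) cT.
    move=> /(theory_poss_explode thT) kna; apply: nbot; apply: kna.
    exact: (theory_neg_know thT i a).1.
  have := all Y XY; rewrite (IH sa subs Y T' rY) le_one_value; last exact: em.
  exact.
have [T' rT'] := svalP Y; have [cT' _] := rT'; have [thT' _ _] := cT'.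
rewrite (IH sa subs Y T' rT') le_one_value; last exact: em.
(* [ax_T'] turns [~~ a] into [Poss i (~~ a)], that is [~~ Know i a], in [T']; yet [Know i a] has
   value [tv1] in [T] and hence in [T']. *)
move=> T'na; have : tv1 <= value T (Know i a).
  by apply/le_one_value => //; exact: em.
rewrite (accE Y T' XY rT') le_one_value; last exact: em.
apply; apply: (theory_neg_know thT' i a).2.
exact: (theory_mp_ax thT' (ax_T' _ _)).
Qed.

End Model.
End Canonical.

(** * Completeness by refuting an unprovable static form *)

Theorem theorem42 (P : countType) (N : finType) (a : form P N) :
  valid a -> provable a.
Proof.
move=> va; have [b sb [ab evalE]] := reduction a.
have thP := @theory_provable P N.
apply/(theory_equ thP ab).1; apply: contrapT => npb.
have thE := theory_extend (StrongNeg b) thP.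
have [|T cT sub] := lindenbaum (negations (subformulas b)) thE.
  exists b => nbb; apply: npb.
  by apply: theory_strong_cases nbb => //; exact: extend_mem.
(* Validity designates [a], hence [b], at the point of [T], so [T] would contain [b] besides
   [StrongNeg b]. *)
have := va _ (canonical_point b cT : canonical_model _).
have rT : realizes (subformulas b) (sval (canonical_point b cT)) T.
  exact: realizes_value.
rewrite evalE (truth b sb _ rT) // designated_value.
have [bL _] := In_negations (subformulas_self b).
apply/(maximal_strong_neg cT bL)/sub; exact: extend_mem.
Qed.
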